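(* Let $\mathcal{K}$ be a class of metric algebras that is closed under ultraproducts, and let $\Delta\cup\{s=_\varepsilon t\}$ be a set of metric equations over a set $X$. If $\Delta\models_{\mathcal K} s=_\varepsilon t$, then for every $\varepsilon'>\varepsilon$ there is a finite subset $\Delta_0\subseteq\Delta$ such that $\Delta_0\models_{\mathcal K} s=_{\varepsilon'} t$.
   Context: Fix an algebraic signature $\Sigma$. A metric algebra is a $\Sigma$-algebra with an extended metric $d\colon A\times A\to[0,\infty]$. For a filter $\mathcal F$ on nonempty $I$ and metric algebras $(A_i)_{i\in I}$ let $\theta((x_i),(y_i))=\inf_{J\in\mathcal F}\sup_{i\in J}d_i(x_i,y_i)$ on $\prod_iA_i$; the reduced product exists if $\{\theta=0\}$ is a congruence of the product $\Sigma$-algebra, and is the quotient by that relation with the metric induced by $\theta$ and induced operations; for an ultrafilter it is called ultraproduct. $\mathcal K$ is closed under ultraproducts if for every nonempty $I$, every ultrafilter on $I$ and every $I$-indexed family in $\mathcal K$ the ultraproduct exists and belongs to $\mathcal K$ (classes are closed under isomorphism). A metric equation over $X$ is $s=_\varepsilon t$ with $s,t$ $\Sigma$-terms over $X$, $\varepsilon\ge 0$; $A,v\models s=_\varepsilon t$ for $v\colon X\to A$ means $d(\llbracket s\rrbracket_v,\llbracket t\rrbracket_v)\le\varepsilon$. For a set $\Delta$ of metric equations over $X$, $\Delta\models_{\mathcal K}s=_\varepsilon t$ means: for every $A\in\mathcal K$ and every $v\colon X\to A$ with $A,v\models\Delta$, we have $A,v\models s=_\varepsilon t$. *)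

(* Defs.v *)
From mathcomp Require Import all_boot all_order all_algebra.
From mathcomp Require Import boolp classical_sets functions cardinality filter.
From mathcomp Require Import interval_inference reals ereal.

Set Implicit Arguments.
Unset Strict Implicit.
Unset Printing Implicit Defensive.

Import Order.TTheory GRing.Theory Num.Theory.

Local Open Scope classical_set_scope.
Local Open Scope ring_scope.
Local Open Scope ereal_scope.

Record signature := Signature { op : Type; arity : op -> nat }.

(* Carriers may be empty. *)
Record algebra (S : signature) := Algebra {
  carrier :> Type;
  interp : forall f : op S, ('I_(arity f) -> carrier) -> carrier }.

Record extended_metric (R : realType) (T : Type) (d : T -> T -> \bar R) : Prop :=
  ExtendedMetric {
    ext_metric_ge0 : forall x y, 0 <= d x y;
    ext_metric_eq0 : forall x y, d x y = 0 <-> x = y;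
    ext_metric_sym : forall x y, d x y = d y x;
    ext_metric_triangle : forall x y z, d x z <= d x y + d y z }.

(* The operations need not be nonexpansive, nor even continuous. *)
Record metric_algebra (S : signature) (R : realType) := MetricAlgebra {
  malg :> algebra S;
  dist : malg -> malg -> \bar R;
  distP : extended_metric dist }.

Definition is_hom (S : signature) (A B : algebra S) (h : A -> B) : Prop :=
  forall (f : op S) (a : 'I_(arity f) -> A),
    h (interp a) = interp (fun k => h (a k)).

Definition isomorphic (S : signature) (R : realType)
    (A B : metric_algebra S R) : Prop :=
  exists h : A -> B, [/\ is_hom h, bijective h &
    forall x y, dist (h x) (h y) = dist x y].

Record congruence (S : signature) (A : algebra S) (E : A -> A -> Prop) : Prop :=
  Congruence {
    congr_refl : forall x, E x x;
    congr_sym : forall x y, E x y -> E y x;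
    congr_trans : forall x y z, E x y -> E y z -> E x z;
    congr_interp : forall (f : op S) (a b : 'I_(arity f) -> A),
      (forall k, E (a k) (b k)) -> E (interp a) (interp b) }.

Section Quotient.
Variables (S : signature) (A : algebra S) (E : A -> A -> Prop).
Hypothesis HE : congruence E.

Local Open Scope quotient_scope.

Definition congr_rel : rel {classic A} := fun x y => `[< E x y >].

Lemma congr_rel_refl : reflexive congr_rel.
Proof. by move=> x; apply/asboolP; exact: congr_refl. Qed.

Lemma congr_rel_sym : symmetric congr_rel.
Proof.
by move=> x y; apply/asboolP/asboolP => /(congr_sym HE).
Qed.

Lemma congr_rel_trans : transitive congr_rel.
Proof.
move=> y x z /asboolP xy /asboolP yz; apply/asboolP.
exact: (congr_trans HE xy yz).
Qed.

Definition congr_equiv : equiv_rel {classic A} :=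
  EquivRel congr_rel congr_rel_refl congr_rel_sym congr_rel_trans.

Definition quot_algebra : algebra S :=
  @Algebra S {eq_quot congr_equiv}
    (fun f a => \pi_{eq_quot congr_equiv} (interp (fun k => repr (a k) : A))).

Definition quot_proj (x : A) : quot_algebra := \pi_{eq_quot congr_equiv} x.

Definition quot_repr (x : quot_algebra) : A := repr (x : {eq_quot congr_equiv}).

Lemma quot_projP (x y : A) : quot_proj x = quot_proj y <-> E x y.
Proof.
split=> [/(@eqmodP _ congr_equiv)/asboolP //|xy].
by apply/(@eqmodP _ congr_equiv)/asboolP.
Qed.

Lemma quot_reprK (x : quot_algebra) : quot_proj (quot_repr x) = x.
Proof. exact: (@reprK _ {eq_quot congr_equiv}). Qed.

Lemma quot_proj_hom : is_hom quot_proj.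
Proof.
move=> f a; apply/quot_projP; apply: (congr_interp HE) => k.
by apply/quot_projP; rewrite [RHS]quot_reprK.
Qed.

End Quotient.

Definition prod_algebra (S : signature) (I : Type) (A : I -> algebra S) :
    algebra S :=
  @Algebra S (forall i, A i) (fun f a i => interp (fun k => a k i)).

Section ReducedProduct.
Variables (S : signature) (R : realType) (I : Type).
Variables (F : set_system I) (A : I -> metric_algebra S R).

(* The supremum is taken in [0, +oo], hence the added 0: it only matters for
   the empty index set, whose supremum in \bar R would be -oo. *)
Definition theta (x y : prod_algebra A) : \bar R :=
  ereal_inf [set ereal_sup (0 |` [set dist (x i) (y i) | i in J]) | J in F].

Definition theta0 (x y : prod_algebra A) : Prop := theta x y = 0.

Lemma theta_ge0 x y : 0 <= theta x y.
Proof.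
by apply: le_ereal_inf_tmp => _ [J _ <-]; apply: ereal_sup_ubound; left.
Qed.

Lemma theta_sym x y : theta x y = theta y x.
Proof.
rewrite /theta; congr ereal_inf; apply: eq_imagel => J _.
congr (ereal_sup (_ `|` _)); apply: eq_imagel => i _.
exact: (ext_metric_sym (distP (A i))).
Qed.

Lemma theta_triangle (FF : Filter F) x y z :
  theta x z <= theta x y + theta y z.
Proof.
have xy0 := theta_ge0 x y; have yz0 := theta_ge0 y z.
have [->|xyoo] := eqVneq (theta x y) +oo.
  by rewrite addye ?leey // gt_eqF // (lt_le_trans ltNy0).
have [->|yzoo] := eqVneq (theta y z) +oo.
  by rewrite addey ?leey // gt_eqF // (lt_le_trans ltNy0).
have fxy : theta x y \is a fin_num by rewrite ge0_fin_numE // ltey.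
have fyz : theta y z \is a fin_num by rewrite ge0_fin_numE // ltey.
apply/lee_addgt0Pr => e e0.
have e20 : (0 < e / 2)%R by rewrite divr_gt0.
have [_ [J FJ <-] ltJ] := lb_ereal_inf_adherent e20 fxy.
have [_ [K FK <-] ltK] := lb_ereal_inf_adherent e20 fyz.
rewrite -/(theta x y) in ltJ; rewrite -/(theta y z) in ltK.
rewrite [e]splitr EFinD addeACA.
apply: le_trans (leeD (ltW ltJ) (ltW ltK)).
apply: ge_ereal_inf.
exists (ereal_sup (0 |` [set dist (x i) (z i) | i in J `&` K])).
  by exists (J `&` K) => //; exact: filterI.
have sup0 (T : set (\bar R)) : 0 <= ereal_sup (0 |` T).
  by apply: ereal_sup_ubound; left.
apply: ge_ereal_sup => _ [-> | [i [Ji Ki] <-]]; first exact: adde_ge0.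
apply: le_trans (ext_metric_triangle (distP (A i)) _ (y i) _) _.
by apply: leeD; apply: ereal_sup_ubound; right; exists i.
Qed.

Hypothesis FF : Filter F.
Hypothesis cong : congruence theta0.

Definition reduced_dist (x y : quot_algebra cong) : \bar R :=
  theta (quot_repr x) (quot_repr y).

(* reduced_dist does not depend on the chosen representatives. *)
Lemma reduced_distE (x y : prod_algebra A) :
  reduced_dist (quot_proj cong x) (quot_proj cong y) = theta x y.
Proof.
have le_theta (x1 x2 y1 y2 : prod_algebra A) :
    theta0 x1 x2 -> theta0 y1 y2 -> theta x1 y1 <= theta x2 y2.
  move=> x12 y12; apply: le_trans (theta_triangle FF _ x2 _) _.
  rewrite x12 add0e; apply: le_trans (theta_triangle FF _ y2 _) _.
  by rewrite [theta y2 y1]theta_sym y12 adde0.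
have E u : theta0 (quot_repr (quot_proj cong u)) u.
  by apply/(quot_projP cong); rewrite quot_reprK.
by apply/eqP; rewrite eq_le !le_theta //; apply: (congr_sym cong); exact: E.
Qed.

Lemma reduced_distP : extended_metric reduced_dist.
Proof.
split=> [x y|x y|x y|x y z].
- exact: theta_ge0.
- split=> [xy0|->]; last exact: (congr_refl cong).
  by rewrite -[x]quot_reprK -[y]quot_reprK; apply/quot_projP.
- exact: theta_sym.
- exact: theta_triangle.
Qed.

Definition reduced_product : metric_algebra S R := MetricAlgebra reduced_distP.

End ReducedProduct.

Definition closed_under_isomorphism (S : signature) (R : realType)
    (K : metric_algebra S R -> Prop) : Prop :=
  forall A B, isomorphic A B -> K A -> K B.

(* The existential quantifies over a proof: it says that the ultraproduct
   exists, i.e. that theta0 is a congruence, and that it lies in K. *)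
Definition closed_under_ultraproducts (S : signature) (R : realType)
    (K : metric_algebra S R -> Prop) : Prop :=
  forall (I : Type) (F : set_system I) (FU : UltraFilter F)
    (A : I -> metric_algebra S R),
    inhabited I -> (forall i, K (A i)) ->
    exists cong : congruence (theta0 F (A := A)), K (reduced_product _ cong).

Inductive term (S : signature) (X : Type) : Type :=
  | Var of X
  | App (f : op S) of ('I_(arity f) -> term S X).

Fixpoint term_eval (S : signature) (X : Type) (A : algebra S) (v : X -> A)
    (t : term S X) : A :=
  match t with
  | Var x => v x
  | App f a => interp (fun k => term_eval v (a k))
  end.

Record metric_equation (S : signature) (X : Type) (R : realType) :=
  MetricEquation { lhs : term S X; rhs : term S X; bound : {nonneg R} }.

Definition satisfies (S : signature) (X : Type) (R : realType)
    (A : metric_algebra S R) (v : X -> A) (e : metric_equation S X R) : Prop :=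
  dist (term_eval v (lhs e)) (term_eval v (rhs e)) <= (bound e)%:num%:E.

Definition entails (S : signature) (X : Type) (R : realType)
    (K : metric_algebra S R -> Prop) (D : set (metric_equation S X R))
    (e : metric_equation S X R) : Prop :=
  forall (A : metric_algebra S R) (v : X -> A), K A ->
    (forall e', D e' -> satisfies v e') -> satisfies v e.

(* Main.v *)
Require Import Defs.
From mathcomp Require Import all_boot all_order all_algebra.
From mathcomp Require Import boolp classical_sets cardinality filter.
From mathcomp Require Import interval_inference reals ereal.

Set Implicit Arguments.
Unset Strict Implicit.

Local Open Scope classical_set_scope.
Local Open Scope ring_scope.

Import Order.TTheory.

(** Suppose no finite [Delta0] works.  Choose for every finite subset [i] of
    [Delta] an algebra of [K] with a valuation that satisfies [i] but violates
    [s =_eps' t], and an ultrafilter on these finite subsets that contains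
    every cone [{j | i `<=` j}].  The ultraproduct of the counterexamples, with
    the componentwise valuation, satisfies [Delta], hence [s =_eps t].  As
    [eps < eps'], some component satisfies [s =_eps' t], a contradiction. *)

Lemma term_eval_hom (S : signature) (X : Type) (A B : algebra S) (h : A -> B)
    (v : X -> A) (t : term S X) :
  is_hom h -> term_eval (fun x => h (v x)) t = h (term_eval v t).
Proof.
move=> hh; elim: t => [//|f a IH] /=.
by rewrite hh; congr interp; apply/funext.
Qed.

Lemma term_eval_prod (S : signature) (X I : Type) (A : I -> algebra S)
    (v : forall i, X -> A i) (t : term S X) :
  term_eval (A := prod_algebra A) (fun x i => v i x) t =
  fun i => term_eval (v i) t.
Proof.
elim: t => [//|f a IH] /=.
by apply: functional_extensionality_dep => i; congr interp; apply/funext => k; rewrite IH.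
Qed.

Section FiniteSubsets.
Variables (T : Type) (D : set T).

Definition finite_subset := {E : set T | E `<=` D /\ finite_set E}.

(** The cones form a filter base: the cone of [E]|[G] lies inside the cones of [E] and of [G], and
    no cone is empty because it contains its own index. The ultrafilter lemma extends the generated
    filter. *)
Lemma ex_ultrafilter_cones :
  exists F : set_system finite_subset, UltraFilter F /\
    forall i : finite_subset, F [set j | sval i `<=` sval j].
Proof.
pose cone (i : finite_subset) := [set j : finite_subset | sval i `<=` sval j].
(* The empty subset is an index even when [D] is empty, so the base is nonempty. *)
pose e0 : finite_subset := exist _ set0 (conj (@sub0set _ D) (finite_set0 T)).
have FP : ProperFilter (filter_from setT cone).
  apply: filter_from_proper; last by move=> i _; exists i; exact: subset_refl.
  apply: filter_from_filter; first by exists e0.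
  move=> [E [ED fE]] [G [GD fG]] _ _.
  have EGD : E `|` G `<=` D /\ finite_set (E `|` G).
    by split; [rewrite subUset | rewrite finite_setU].
  exists (exist _ (E `|` G) EGD) => // j.
  by rewrite /cone /= subUset => -[].
have [F [UF FF]] := ultraFilterLemma FP.
exists F; split=> // i; apply: FF.
by exists i.
Qed.

End FiniteSubsets.

Local Open Scope ereal_scope.

(** The premise [0 <= r] accounts for the 0 adjoined to each supremum, which is the whole supremum
    when [J] is empty. *)
Lemma theta_le (S : signature) (R : realType) (I : Type) (F : set_system I)
    (A : I -> metric_algebra S R) (x y : prod_algebra A) (r : \bar R)
    (J : set I) :
  F J -> 0 <= r -> (forall i, J i -> dist (x i) (y i) <= r) ->
  theta F x y <= r.
Proof.
move=> FJ r0 xyr; apply: ge_ereal_inf.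
exists (ereal_sup (0 |` [set dist (x i) (y i) | i in J])); first by exists J.
by apply: ge_ereal_sup => _ [->//|[i Ji <-]]; exact: xyr.
Qed.

(** The infimum need not be attained, so only a strict bound yields a witness [J]; this is where the
    slack between [eps] and [eps'] is spent. *)
Lemma theta_lt (S : signature) (R : realType) (I : Type) (F : set_system I)
    (A : I -> metric_algebra S R) (x y : prod_algebra A) (r : \bar R) :
  theta F x y < r ->
  exists2 J, F J & forall i, J i -> dist (x i) (y i) < r.
Proof.
move=> /ereal_inf_lt[_ [J FJ <-] ltr]; exists J => // i Ji.
by apply: le_lt_trans ltr; apply: ereal_sup_ubound; right; exists i.
Qed.

Local Close Scope ereal_scope.

Unset Implicit Arguments.
Set Strict Implicit.

Theorem mainTheorem4 (R : realType) (S : signature)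
    (K : metric_algebra S R -> Prop)
    (K_iso : closed_under_isomorphism K)
    (K_ultra : closed_under_ultraproducts K)
    (X : Type) (Delta : set (metric_equation S X R))
    (s t : term S X) (eps : {nonneg R}) :
  entails K Delta (MetricEquation s t eps) ->
  forall eps' : {nonneg R}, eps%:num < eps'%:num ->
  exists Delta0 : set (metric_equation S X R),
    [/\ Delta0 `<=` Delta, finite_set Delta0 &
        entails K Delta0 (MetricEquation s t eps')].
Proof.
move=> Dst eps' lt_eps; apply: contrapT => noD0.
(* Stated as a sigma type rather than an existential, so that [A] and [v] can be projected out as
   functions of [i]. *)
have cex (i : finite_subset Delta) :
    {A : metric_algebra S R & {v : X -> A | [/\ K A,
       forall e, sval i e -> satisfies v e &
       ~ satisfies v (MetricEquation s t eps')]}}.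
  case: i => [E [ED fE]] /=.
  suff /cid[A /cid[v ?]] : exists A : metric_algebra S R, exists v : X -> A,
      [/\ K A, forall e, E e -> satisfies v e &
        ~ satisfies v (MetricEquation s t eps')] by exists A, v.
  apply: contrapT => noA; apply: noD0; exists E; split=> // A v KA Ev.
  by apply: contrapT => nst; apply: noA; exists A, v.
pose A i := projT1 (cex i); pose v i : X -> A i := sval (projT2 (cex i)).
have vP i : [/\ K (A i), forall e, sval i e -> satisfies (v i) e &
    ~ satisfies (v i) (MetricEquation s t eps')] := svalP (projT2 (cex i)).
have [F [UF Fcone]] := ex_ultrafilter_cones Delta.
have inhI : inhabited (finite_subset Delta).
  by have [i _] := filter_ex (@filterT _ F _); exists.
have KA i : K (A i) by case: (vP i).
have [cong KP] := K_ultra _ F UF A inhI KA.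
pose w : X -> reduced_product (@ultra_proper _ _ UF) cong :=
  fun x => quot_proj cong (fun i => v i x).
have distw p q : dist (term_eval w p) (term_eval w q) =
    theta F (fun i => term_eval (v i) p) (fun i => term_eval (v i) q).
  have wE u : term_eval w u = quot_proj cong (fun i => term_eval (v i) u).
    (* Read backwards, the family of componentwise values is a single evaluation in the product
       algebra, through which the homomorphism [quot_proj] passes. *)
    rewrite -term_eval_prod.
    exact: (term_eval_hom _ _ (quot_proj_hom cong)).
  by rewrite !wE; exact: reduced_distE.
have wD e : Delta e -> satisfies w e.
  move=> De; rewrite /satisfies distw.
  have e1 : [set e] `<=` Delta /\ finite_set [set e].
    by split; [move=> _ -> | exact: finite_set1].
  (* Every index in the cone of [[set e]] contains [e], so its component satisfies [e]. *)
  apply: (theta_le (Fcone (exist _ [set e] e1))).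
    by rewrite lee_fin.
  by move=> i /= ei; have [_ + _] := vP i; apply; exact: ei.
have := Dst _ w KP wD; rewrite /satisfies distw /= => le_st.
have [|J FJ ltJ] := theta_lt (r := eps'%:num%:E) (le_lt_trans le_st _).
  by rewrite lte_fin.
(* [F] is proper, so [J] has a member, and a single one contradicts the choice of the components. *)
have [i Ji] := filter_ex FJ.
by have [_ _] := vP i; apply; exact: (ltW (ltJ i Ji)).
Qed.
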